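(* Let $k\ge4$ be an integer and let $K\subset\mathbb{R}^3$ be a non-degenerate tetrahedron. Then $$\operatorname{div}\Sigma_{K,b}=\Big\{v\in P_{k-1}(K,\mathbb{R}^3):\int_K v\cdot p\,d\mathbf{x}=0\ \text{ for all } p\in R(K)\Big\},$$ i.e. the space of divergences of the local edge-bubble stress space $\Sigma_{K,b}$ is exactly the subspace of displacement polynomials on $K$ that are orthogonal to the local rigid motions.
   Context: $P_m(K,X)$ denotes polynomials of total degree at most $m$ on $K$ with values in $X$ ($X=\mathbb{R}$ if omitted); the divergence of a matrix field is taken row-wise. Let $\mathbf{x}_0,\mathbf{x}_1,\mathbf{x}_2,\mathbf{x}_3$ be the vertices of $K$, let $\lambda_0,\dots,\lambda_3$ be the corresponding barycentric coordinates, and for $0\le i<j\le3$ let $\mathbf{t}_{ij}=\mathbf{x}_j-\mathbf{x}_i$ (column vector) and $T_{ij}=\mathbf{t}_{ij}\mathbf{t}_{ij}^T$, a symmetric $3\times3$ matrix. The local edge-bubble space is $$\Sigma_{K,b}=\Big\{\sum_{0\le i<j\le3}\lambda_i\lambda_j\,p_{ij}\,T_{ij}: p_{ij}\in P_{k-2}(K)\Big\}.$$ The space of rigid motions is $$R(K)=\left\{\begin{pmatrix}a_1-a_4y-a_5z\\ a_2+a_4x-a_6z\\ a_3+a_5x+a_6y\end{pmatrix}: a_1,\dots,a_6\in\mathbb{R}\right\},$$ where $\mathbf{x}=(x,y,z)$. *)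

(* Defs.v *)
From HB Require Import structures.
From mathcomp Require Import all_boot all_order all_algebra.
From mathcomp Require Import all_classical all_reals all_analysis.
(* The notations of [mpoly] clash with those of mathcomp-analysis: [mpoly n R],
   [meval], [mderiv], [mpolyC], [mpolyX] are used by name. *)
From mathcomp Require Import -(notations) mpoly.

Set Implicit Arguments.
Unset Strict Implicit.
Unset Printing Implicit Defensive.

Import Order.TTheory GRing.Theory Num.Theory.
Import numFieldNormedType.Exports.

Local Open Scope classical_set_scope.
Local Open Scope ring_scope.

(* Polynomials in (x, y, z).  A tetrahedron has nonempty interior, so that a
   polynomial function on it is the same thing as a formal polynomial. *)
Notation poly3 R := (mpoly 3 R) (only parsing).

Section Fields.
Variable R : realType.

Definition coordX : 'cV[poly3 R]_3 := \col_i mpolyX R (mnm1 i).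

(* [msize q] is 1 + the total degree of [q], and 0 for [q = 0]. *)
Definition Pm (m : nat) : set (poly3 R) := [set q | (msize q <= m.+1)%N].

Definition Pmv (m : nat) : set 'cV[poly3 R]_3 :=
  [set v | forall i, Pm m (v i 0)].

Definition mxdiv (tau : 'M[poly3 R]_3) : 'cV[poly3 R]_3 :=
  \col_i \sum_(j < 3) mderiv j (tau i j).

Definition rigid_motions : set 'cV[poly3 R]_3 :=
  [set p | exists a1 a2 a3 a4 a5 a6 : R,
     let C := @mpolyC 3 R in
     let x := coordX 0 0 in let y := coordX 1 0 in let z := coordX 2 0 in
     p = \col_(i < 3) [:: C a1 - C a4 * y - C a5 * z;
                          C a2 + C a4 * x - C a6 * z;
                          C a3 + C a5 * x + C a6 * y]`_i].

(* Lebesgue measure is available on the product type [R * R * R], not on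
   ['cV[R]_3]; [vec3] is the identification of the two. *)
Definition lebesgue3 := ((@lebesgue_measure R \x @lebesgue_measure R)
                           \x @lebesgue_measure R)%E.

Definition vec3 (y : R * R * R) : 'cV[R]_3 :=
  \col_(i < 3) [:: y.1.1; y.1.2; y.2]`_i.

Definition peval (q : poly3 R) (y : 'cV[R]_3) : R := meval (fun i => y i 0) q.

Definition dotv (v p : 'cV[poly3 R]_3) : poly3 R := \sum_(i < 3) v i 0 * p i 0.

End Fields.

Section Tetrahedron.
Variables (R : realType) (x : 'I_4 -> 'cV[R]_3).

Definition edge (i j : 'I_4) : 'cV[R]_3 := x j - x i.

(* The four vertices are affinely independent. *)
Definition nondegenerate_tetra : bool :=
  free [tuple edge ord0 (lift ord0 j) | j < 3].

Definition tetra : set (R * R * R) :=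
  [set y | exists w : 'I_4 -> R,
     [/\ forall i, 0 <= w i, \sum_i w i = 1 & vec3 y = \sum_i w i *: x i]].

(* Column [j] is [(1, x_j)]. *)
Definition vertex_mx : 'M[R]_(1 + 3) :=
  col_mx (const_mx 1) (\matrix_(r < 3, j < 1 + 3) x j r 0).

(* The solution of [\sum_i lambda_i = 1], [\sum_i lambda_i x_i = (x, y, z)]:
   see [sum_bary] and [sum_bary_vertex]. *)
Definition bary (i : 'I_4) : poly3 R :=
  (map_mx (@mpolyC 3 R) (invmx vertex_mx)
     *m col_mx (const_mx 1 : 'cV_1) (coordX R)) i 0.

Definition edge_mx (i j : 'I_4) : 'M[R]_3 := edge i j *m (edge i j)^T.

Definition edge_bubbles (k : nat) : set 'M[poly3 R]_3 :=
  [set tau | exists p : 'I_4 -> 'I_4 -> poly3 R,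
     (forall i j : 'I_4, (i < j)%N -> Pm (k - 2) (p i j)) /\
     tau = \sum_(i < 4) \sum_(j < 4 | (i < j)%N)
             (bary i * bary j * p i j) *: map_mx (@mpolyC 3 R) (edge_mx i j)].

Lemma vertex_mx_unit : nondegenerate_tetra -> vertex_mx \in unitmx.
Proof.
move=> fr; rewrite -unitmx_tr -row_free_unit -kermx_eq0.
apply/rowV0P => u /sub_kermxP uV.
have uE r : \sum_j u 0 j * vertex_mx r j = 0.
  transitivity ((u *m vertex_mx^T) 0 r); last by rewrite uV mxE.
  by rewrite mxE; apply: eq_bigr => j _; rewrite [in RHS]mxE.
have u1 : \sum_j u 0 j = 0.
  rewrite -[RHS](uE (lshift 3 ord0)); apply: eq_bigr => j _.
  by rewrite /vertex_mx col_mxEu mxE mulr1.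
have ux : \sum_j u 0 j *: x j = 0.
  apply/matrixP => r c; rewrite summxE !mxE -[RHS](uE (rshift 1 r)).
  apply: eq_bigr => j _; rewrite /vertex_mx col_mxEd !mxE.
  by rewrite (ord1 c).
have u0 : u 0 ord0 = - \sum_(j < 3) u 0 (lift ord0 j).
  by apply/eqP; rewrite -addr_eq0 -[X in _ == X]u1 (big_ord_recl 3).
have ue : \sum_(j < 3) u 0 (lift ord0 j) *: edge ord0 (lift ord0 j) = 0.
  rewrite -[RHS]ux (big_ord_recl 3) u0 scaleNr scaler_suml -sumrN -big_split /=.
  by apply: eq_bigr => j _; rewrite /edge scalerBr addrC.
have c0 (j : 'I_3) : u 0 (lift ord0 j) = 0.
  move/freeP: fr => /(_ (fun j => u 0 (lift ord0 j))); apply.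
  by rewrite -[RHS]ue; apply: eq_bigr => i _; rewrite -tnth_nth tnth_mktuple.
apply/rowP => j; rewrite mxE.
case: (unliftP ord0 j) => [i ->|->]; first exact: c0.
by rewrite u0 big1 ?oppr0.
Qed.

Lemma vertex_mx_bary (r : 'I_(1 + 3)) : nondegenerate_tetra ->
  \sum_i mpolyC 3 (vertex_mx r i) * bary i
  = (col_mx (const_mx 1 : 'cV_1) (coordX R)) r 0.
Proof.
move=> /vertex_mx_unit Vu.
set Y := col_mx _ _; have : map_mx (@mpolyC 3 R) vertex_mx
    *m (map_mx (@mpolyC 3 R) (invmx vertex_mx) *m Y) = Y.
  by rewrite mulmxA -map_mxM mulmxV// map_mx1 mul1mx.
move=> /matrixP /(_ r 0) <-; rewrite [RHS]mxE.
by apply: eq_bigr => i _; rewrite [in RHS]mxE.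
Qed.

Lemma sum_bary : nondegenerate_tetra -> \sum_i bary i = 1.
Proof.
move=> /(vertex_mx_bary (lshift 3 ord0)); rewrite col_mxEu mxE => <-.
by apply: eq_bigr => i _; rewrite /vertex_mx col_mxEu mxE mpolyC1 mul1r.
Qed.

Lemma sum_bary_vertex : nondegenerate_tetra ->
  \sum_i bary i *: map_mx (@mpolyC 3 R) (x i) = coordX R.
Proof.
move=> nd; apply/matrixP => r c; rewrite (ord1 c) summxE.
have := vertex_mx_bary (rshift 1 r) nd; rewrite col_mxEd => <-.
apply: eq_bigr => i _.
by rewrite /vertex_mx col_mxEd !mxE mulrC.
Qed.

End Tetrahedron.

(* Main.v *)
Require Import Defs.
From HB Require Import structures.
From mathcomp Require Import all_boot all_order all_algebra.
From mathcomp Require Import all_classical all_reals all_analysis.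
From mathcomp Require Import measurable_realfun.
From mathcomp Require Import ring lra zify.
From mathcomp Require Import -(notations) mpoly.
Import Order.TTheory GRing.Theory Num.Theory.
Import numFieldNormedType.Exports.

Local Open Scope classical_set_scope.
Local Open Scope ring_scope.

Set Implicit Arguments.
Unset Strict Implicit.
Unset Printing Implicit Defensive.

(** For the edge [t = x_b - x_a], the divergence of [f *: t t^T] is
    [(d_t f) *: t], where [d_t] is the directional derivative.  If
    [f = lambda_a lambda_b p], then [f] vanishes on the two faces that are not
    parallel to [t], so that integration by parts along [t] gives
    [\int_K div (f t t^T) . u = - \int_K f (t^T eps(u) t)], with no boundary
    term.  Rigid motions have [eps(u) = 0], hence are orthogonal to all
    divergences.  Conversely, let [u] be the component of [v] orthogonal to the
    divergences; choosing [p = t^T eps(u) t], of degree [k - 2], yields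
    [\int_K lambda_a lambda_b p^2 = 0], hence [t^T eps(u) t = 0] for all six
    edges.  As the [t t^T] span the symmetric matrices, [eps(u) = 0], i.e. [u]
    is rigid; if [v] is orthogonal to the rigid motions, this forces [u = 0].

    Integration by parts along [t] needs no change of variables: the integral of
    [(g(y + t/n) - g(y)) n] vanishes by translation invariance, where [g] is [f]
    extended by 0 outside [K], and dominated convergence applies. *)

(** * Translation invariance of the Lebesgue measure *)

Section MeasurePreservation.
Context (R : realType).
Local Open Scope ereal_scope.

Definition measure_preserving d (T : measurableType d) (mu : set T -> \bar R)
    (s : T -> T) :=
  forall A, measurable A -> mu (s @^-1` A) = mu A.

Lemma ge0_integral_preserving d (T : measurableType d)
    (mu : {measure set T -> \bar R}) (s : T -> T) (f : T -> \bar R) :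
  measurable_fun [set: T] s -> measure_preserving mu s ->
  measurable_fun [set: T] f -> (forall y, 0 <= f y) ->
  \int[mu]_y f (s y) = \int[mu]_y f y.
Proof.
move=> ms ps mf f0.
rewrite -[LHS](@ge0_integral_pushforward _ _ _ _ _ _ ms mu setT f) //.
by apply: eq_measure_integral => A mA _; exact: ps.
Qed.

Lemma integral_preserving d (T : measurableType d)
    (mu : {measure set T -> \bar R}) (s : T -> T) (f : T -> \bar R) :
  measurable_fun [set: T] s -> measure_preserving mu s ->
  measurable_fun [set: T] f ->
  \int[mu]_y f (s y) = \int[mu]_y f y.
Proof.
move=> ms ps mf; rewrite integralE [RHS]integralE.
have E1 : \int[mu]_y f^\+ (s y) = \int[mu]_y f^\+ y.
  apply: ge0_integral_preserving => //; exact: measurable_funepos.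
have E2 : \int[mu]_y f^\- (s y) = \int[mu]_y f^\- y.
  apply: ge0_integral_preserving => //; exact: measurable_funeneg.
by rewrite -E1 -E2 !unlock.
Qed.

(** The product measure integrates the [m2]-measure of sections, and the section at [y] of the
    preimage of [A] is the [s2]-preimage of the section of [A] at [s1 y]. Invariance of [m2] and
    then of [m1] concludes. *)
Lemma measure_preserving_prod d1 d2 (T1 : measurableType d1)
    (T2 : measurableType d2) (m1 : {measure set T1 -> \bar R})
    (m2 : {sigma_finite_measure set T2 -> \bar R}) (s1 : T1 -> T1) (s2 : T2 -> T2) :
  measurable_fun setT s1 -> measurable_fun setT s2 ->
  measure_preserving m1 s1 -> measure_preserving m2 s2 ->
  measure_preserving (m1 \x m2) (fun p => (s1 p.1, s2 p.2)).
Proof.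
move=> ms1 ms2 p1 p2 A mA.
rewrite /product_measure1.
rewrite -[RHS](@ge0_integral_preserving _ _ m1 s1) //; last first.
  exact: measurable_fun_xsection.
apply: eq_integral => y _ /=.
rewrite -[RHS]p2; last exact: measurable_xsection.
by congr (m2 _); apply/seteqP; split=> z; rewrite /xsection /= !inE.
Qed.

End MeasurePreservation.

Section Lebesgue3.
Variable R : realType.
Let T1 := measurableTypeR R.
Let T3 := (T1 * T1 * T1)%type.
Let mu : {measure set T3 -> \bar R} := @lebesgue3 R.

Lemma measurable_addr (a : R) : measurable_fun [set: T1] (fun y : T1 => y + a : T1).
Proof. exact: measurable_funD. Qed.

(** The pushforward agrees with the Lebesgue measure on half-open intervals, whose length a
    translation keeps; uniqueness of the Lebesgue measure extends this to all measurable sets. *)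
Lemma lebesgue_measure_shift (a : R) :
  measure_preserving (@lebesgue_measure R) (fun y : T1 => y + a : T1).
Proof.
have ms := measurable_addr a; move=> A mA; apply/esym.
apply: (@lebesgue_measure_unique R (pushforward (@lebesgue_measure R) _)) mA.
move=> _ [[u v] _ <-].
have E : (fun y : T1 => y + a : T1) @^-1` `]u, v]%classic = `]u - a, v - a]%classic.
  by apply/seteqP; split=> z /=; rewrite !in_itv/= ltrBlDr lerBrDr.
transitivity (@lebesgue_measure R `]u - a, v - a]%classic); last first.
  by rewrite /pushforward; congr (lebesgue_measure _); exact/esym.
rewrite !lebesgue_measure_itv /= !lte_fin ltrD2r.
by rewrite -!EFinB opprB addrA subrK.
Qed.

Definition shift3 (v : 'cV[R]_3) (y : R * R * R) : R * R * R :=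
  (y.1.1 + v 0 0, y.1.2 + v 1 0, y.2 + v 2%:R 0).

Lemma vec3_shift v y : vec3 (shift3 v y) = vec3 y + v.
Proof.
apply/colP => i; rewrite !mxE.
by case: i => [[|[|[|//]]] hi] /=; congr (_ + v _ _); apply: val_inj.
Qed.

Lemma measurable_shift3 v : measurable_fun [set: T3] (shift3 v : T3 -> T3).
Proof.
have mc : measurable_fun [set: T3] (fun y : T3 => y.1.1 : T1).
  exact: (measurableT_comp measurable_fst measurable_fst).
have mc' : measurable_fun [set: T3] (fun y : T3 => y.1.2 : T1).
  exact: (measurableT_comp measurable_snd measurable_fst).
by apply: measurable_fun_pair; [apply: measurable_fun_pair|];
  apply: (measurableT_comp (measurable_addr _)).
Qed.

Lemma lebesgue3_shift v : measure_preserving mu (shift3 v : T3 -> T3).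
Proof.
apply: (@measure_preserving_prod R _ _ (T1 * T1)%type T1
  (@lebesgue_measure R \x @lebesgue_measure R)%E _
  (fun p => (p.1 + v 0 0, p.2 + v 1 0)) (fun y => y + v 2%:R 0)).
- by apply: measurable_fun_pair; exact: (measurableT_comp (measurable_addr _)).
- exact: measurable_addr.
- apply: (@measure_preserving_prod R _ _ T1 T1 _ _
    (fun y => y + v 0 0) (fun y => y + v 1 0)); try exact: measurable_addr;
  exact: lebesgue_measure_shift.
- exact: lebesgue_measure_shift.
Qed.

End Lebesgue3.

(** * Directional derivatives of polynomial functions *)

Lemma mpoly_ring_ind (n : nat) (A : comNzRingType) (P : mpoly n A -> Prop) :
  (forall c, P (mpolyC n c)) -> (forall i, P (mpolyX A (mnm1 i))) ->
  (forall p q : mpoly n A, P p -> P q -> P (p + q)) ->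
  (forall p q : mpoly n A, P p -> P q -> P (p * q)) -> forall p, P p.
Proof.
move=> PC PX PD PM p; rewrite (mpolyE p).
apply: (big_ind P) => [||m _]; [by rewrite -mpolyC0|exact: PD|].
rewrite -mul_mpolyC; apply: (PM) => //; rewrite mpolyXE_id.
apply: (big_ind P) => [||i _]; [by rewrite -mpolyC1|exact: PM|].
elim: (fun_of_multinom m _) => [|k IH]; first by rewrite expr0 -mpolyC1.
by rewrite exprS; exact: PM.
Qed.

Section PolynomialCalculus.
Variable R : realType.
Implicit Types (p q : poly3 R) (y v : 'cV[R]_3).

Lemma pevalC c y : peval (mpolyC 3 c) y = c.
Proof. exact: mevalC. Qed.

Lemma pevalX i y : peval (mpolyX R (mnm1 i)) y = y i 0.
Proof. exact: mevalXU. Qed.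

Lemma pevalD p q y : peval (p + q) y = peval p y + peval q y.
Proof. exact: mevalD. Qed.

Lemma pevalM p q y : peval (p * q) y = peval p y * peval q y.
Proof. exact: mevalM. Qed.

Lemma pevalZ c p y : peval (c *: p) y = c * peval p y.
Proof. exact: mevalZ. Qed.

Lemma peval_sum (I : finType) (F : I -> poly3 R) y :
  peval (\sum_i F i) y = \sum_i peval (F i) y.
Proof. exact: raddf_sum. Qed.

Definition dderiv v p := \sum_(r < 3) v r 0 *: mderiv r p.

Lemma dderivC v c : dderiv v (mpolyC 3 c) = 0.
Proof. by apply: big1 => r _; rewrite mderivC scaler0. Qed.

Lemma dderivX v i : dderiv v (mpolyX R (mnm1 i)) = mpolyC 3 (v i 0).
Proof.
rewrite /dderiv (bigD1 i) //= big1 => [|r ri]; rewrite mderivX mnm1E.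
  have -> : mnm_sub (mnm1 i) (mnm1 i) = mnm0.
    by apply/mnmP => j; rewrite mnmE subnn mnm0E.
  by rewrite eqxx scale1r mpolyX0 addr0 alg_mpolyC.
by rewrite eq_sym (negPf ri) scale0r scaler0.
Qed.

Lemma dderivD v p q : dderiv v (p + q) = dderiv v p + dderiv v q.
Proof.
by rewrite /dderiv -big_split; apply: eq_bigr => r _; rewrite mderivD scalerDr.
Qed.

Lemma dderiv_sum v (I : Type) (r : seq I) (P : pred I) (F : I -> poly3 R) :
  dderiv v (\sum_(i <- r | P i) F i) = \sum_(i <- r | P i) dderiv v (F i).
Proof.
by apply: (big_morph (dderiv v) (dderivD v)); rewrite -mpolyC0 dderivC.
Qed.

Lemma dderivZ v c p : dderiv v (c *: p) = c *: dderiv v p.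
Proof.
rewrite /dderiv scaler_sumr; apply: eq_bigr => r _.
by rewrite mderivZ !scalerA mulrC.
Qed.

Lemma dderivN v p : dderiv v (- p) = - dderiv v p.
Proof. by rewrite -scaleN1r dderivZ scaleN1r. Qed.

Lemma dderivM v p q : dderiv v (p * q) = dderiv v p * q + p * dderiv v q.
Proof.
rewrite /dderiv mulr_suml mulr_sumr -big_split; apply: eq_bigr => r _.
by rewrite mderivM scalerDr scalerAl scalerAr.
Qed.

Lemma dderiv_delta i p : dderiv (delta_mx i 0) p = mderiv i p.
Proof.
rewrite /dderiv (bigD1 i) //= big1 => [|r ri]; rewrite mxE eqxx ?eqxx.
  by rewrite scale1r addr0.
by rewrite (negPf ri) scale0r.
Qed.

Definition box (M : R) y := forall i, `|y i 0| <= M.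

(** The class of admissible Taylor remainders: uniform bounds for base points in a box and
    increments at most 1. It is stable under sums and products, so remainders can be built by
    induction on the polynomial. *)
Definition box_bounded (M : R) (F : 'cV[R]_3 -> R -> R) :=
  exists C, forall y h, box M y -> `|h| <= 1 -> `|F y h| <= C.

Lemma box_boundedD M F G : box_bounded M F -> box_bounded M G ->
  box_bounded M (fun y h => F y h + G y h).
Proof.
move=> [C hC] [D hD]; exists (C + D) => y h by_ bh.
by rewrite (le_trans (ler_normD _ _)) // lerD ?hC ?hD.
Qed.

Lemma box_boundedM M F G : box_bounded M F -> box_bounded M G ->
  box_bounded M (fun y h => F y h * G y h).
Proof.
move=> [C hC] [D hD]; exists (C * D) => y h by_ bh.
by rewrite normrM ler_pM ?hC ?hD.
Qed.

Lemma box_bounded_id M : box_bounded M (fun _ h => h).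
Proof. by exists 1. Qed.

Lemma box_bounded_cst M c : box_bounded M (fun _ _ => c).
Proof. by exists `|c|. Qed.

Lemma box_bounded_peval M q : box_bounded M (fun y _ => peval q y).
Proof.
elim/mpoly_ring_ind: q => [c|i|p q Bp Bq|p q Bp Bq].
- by exists `|c| => y h _ _; rewrite pevalC.
- by exists M => y h + _; rewrite pevalX; apply.
- have [C hC] := box_boundedD Bp Bq.
  by exists C => y h by_ bh; rewrite pevalD (hC y h).
- have [C hC] := box_boundedM Bp Bq.
  by exists C => y h by_ bh; rewrite pevalM (hC y h).
Qed.

Lemma peval_taylor M v q : exists r, box_bounded M r /\
  forall y h, peval q (y + h *: v) =
    peval q y + h * peval (dderiv v q) y + h ^+ 2 * r y h.
Proof.
elim/mpoly_ring_ind: q => [c|i|p q [r [Br hr]] [s [Bs hs]]|p q [r [Br hr]] [s [Bs hs]]].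
- exists (fun _ _ => 0); split; first exact: box_bounded_cst.
  by move=> y h; rewrite dderivC -mpolyC0 !pevalC; ring.
- exists (fun _ _ => 0); split; first exact: box_bounded_cst.
  by move=> y h; rewrite dderivX pevalC !pevalX !mxE; ring.
- exists (fun y h => r y h + s y h); split; first exact: box_boundedD.
  by move=> y h; rewrite dderivD !pevalD hr hs; ring.
(* The witness collects everything that carries a factor [h ^+ 2] in the product of the two
   expansions. *)
- exists (fun y h => (peval p y * s y h + peval q y * r y h)
    + (peval (dderiv v p) y * peval (dderiv v q) y
    + h * (peval (dderiv v p) y * s y h + peval (dderiv v q) y * r y h)
    + h * (h * (r y h * s y h)))); split.
    do ?[exact: Br|exact: Bs|exact: box_bounded_peval|exact: box_bounded_id
      |apply: box_boundedD|apply: box_boundedM].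
  by move=> y h; rewrite dderivM !(pevalD, pevalM) hr hs; ring.
Qed.

End PolynomialCalculus.

(** * Formal derivatives: constancy and degree *)

Section DerivativesOfPolynomials.
Variable (n : nat) (A : realDomainType).
Implicit Types p : mpoly n A.

(** A monomial other than 1 contains some variable [i]; a positive integer multiple of its
    coefficient is a coefficient of [mderiv i p], and an ordered domain has no torsion. *)
Lemma mderiv_eq0_const p : (forall i, mderiv i p = 0) -> p = mpolyC n (mcoeff mnm0 p).
Proof.
move=> dp; apply/mpolyP => m; rewrite mcoeffC.
have [->|m0] := eqVneq m mnm0; first by rewrite mulr1.
rewrite mulr0.
have [i mi] : exists i, (0 < m i)%N.
  apply/existsP; apply: contraNT m0 => /existsPn m0.
  by apply/eqP/mnmP => i; rewrite mnm0E; apply/eqP; rewrite -leqn0 leqNgt m0.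
have Um : mnm_add (mnm_sub m (mnm1 i)) (mnm1 i) = m.
  apply/mnmP => j; rewrite !mnmE subnK //.
  by case: eqP => [<-|].
have /eqP := mcoeff_deriv i (mnm_sub m (mnm1 i)) p.
by rewrite dp mcoeff0 Um eq_sym mulrn_eq0 /= => /eqP.
Qed.

Lemma msize_mderiv i p k : (msize p <= k.+1)%N -> (msize (mderiv i p) <= k)%N.
Proof.
move=> pk; rewrite msizeE; apply/bigmax_leqP_seq => m + _.
rewrite mcoeff_msupp mcoeff_deriv => h.
have : mnm_add m (mnm1 i) \in msupp p.
  by rewrite mcoeff_msupp; apply: contraNneq h => ->; rewrite mul0rn.
move=> /msize_mdeg_lt /leq_trans /(_ pk).
by rewrite mdegD mdeg1 addn1 ltnS.
Qed.

End DerivativesOfPolynomials.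

(** * Polynomials vanishing on an open set *)

Section Vanishing.
Variable R : realType.

(** Along the segment the Taylor expansion reduces to [0 = h * d + h ^+ 2 * r], so that the
    derivative [d] is of order [h] for every small positive [h]. *)
Lemma peval_dderiv_eq0 (q : poly3 R) (y v : 'cV[R]_3) (e : R) : 0 < e ->
  (forall h, 0 <= h <= e -> peval q (y + h *: v) = 0) -> peval (dderiv v q) y = 0.
Proof.
move=> e0 q0; set d := peval _ _; apply/eqP; apply/negP => /negP dn0.
have [r [[C hC] hr]] := peval_taylor (\sum_i `|y i 0|) v q.
have by_ : box (\sum_i `|y i 0|) y.
  by move=> i; rewrite (bigD1 i) //= lerDl sumr_ge0.
have C0 : 0 <= C by have := hC y 0 by_; rewrite normr0 => /(_ ler01); exact: le_trans.
have d0 : 0 < `|d| by rewrite normr_gt0.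
(* The third bound makes [h * C] smaller than the norm of [d], against [d = - (h * r)] with [r]
   bounded by [C]. *)
pose h := Num.min (Num.min e 1) (`|d| / (2 * (C + 1))).
have h0 : 0 < h by rewrite !lt_min e0 ltr01 /= divr_gt0 // mulr_gt0 // ltr_wpDl.
have he : h <= e by rewrite /h !ge_min lexx.
have h1 : h <= 1 by rewrite /h !ge_min lexx orbT.
have hd : h * (2 * (C + 1)) <= `|d|.
  by rewrite -ler_pdivlMr ?mulr_gt0 ?ltr_wpDl // /h ge_min lexx orbT.
have := hr y h; rewrite q0 ?(ltW h0) //.
have -> : peval q y = 0 by rewrite -(q0 0) ?scale0r ?addr0 // lexx ltW.
rewrite -/d add0r expr2 -mulrA -mulrDr => /esym/eqP; rewrite mulf_eq0 gt_eqF //=.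
rewrite addr_eq0 => /eqP dE.
have := hC y h by_; rewrite gtr0_norm // => /(_ h1) rC.
suff : `|d| <= h * C by nra.
by rewrite dE normrN normrM gtr0_norm // ler_wpM2l // ltW.
Qed.

(** Openness along rays only: directional derivatives ask for no more, and sets cut out by strict
    affine inequalities satisfy it by direct computation. *)
Definition algebraically_open (U : 'cV[R]_3 -> Prop) :=
  forall y v, U y -> exists2 e, 0 < e & forall h, 0 <= h <= e -> U (y + h *: v).

(** Induction on the size: the partial derivatives also vanish on [U] and are smaller, hence zero,
    so [q] is a constant, whose value is read off at [y0]. *)
Lemma poly_eq0_open (U : 'cV[R]_3 -> Prop) (q : poly3 R) y0 :
  algebraically_open U -> U y0 -> (forall y, U y -> peval q y = 0) -> q = 0.
Proof.
move=> oU Uy0; have [k] := ubnP (msize q).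
elim: k q => [//|k IH] q; rewrite ltnS => qk q0.
have qc : q = mpolyC 3 (mcoeff mnm0 q).
  apply: mderiv_eq0_const => i.
  have [q1|q1] := leqP (msize q) 0.
    by move: q1; rewrite leqn0 msize_poly_eq0 => /eqP ->; exact: mderiv0.
  apply: IH.
    rewrite -(prednK q1) in qk *.
    by apply: leq_trans qk; rewrite ltnS; apply: msize_mderiv; rewrite prednK.
  move=> y Uy; rewrite -dderiv_delta.
  have [e e0 he] := oU y (delta_mx i 0) Uy.
  by apply: (peval_dderiv_eq0 e0) => h /he /q0.
by have := q0 y0 Uy0; rewrite qc pevalC => ->; exact: mpolyC0.
Qed.

End Vanishing.

(** * The tetrahedron in barycentric coordinates *)

Section BarycentricCoordinates.
Variables (R : realType) (x : 'I_4 -> 'cV[R]_3).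
Hypothesis nd : nondegenerate_tetra x.
Implicit Types (y v : 'cV[R]_3).

(** The linear part of the affine function [bary x i], that is, its constant derivative in direction
    [v]. *)
Definition bary_slope (i : 'I_4) v : R :=
  (invmx (vertex_mx x) *m col_mx (0 : 'cV_1) v) i 0.

Lemma peval_bary i y :
  peval (bary x i) y = (invmx (vertex_mx x) *m col_mx (const_mx 1 : 'cV_1) y) i 0.
Proof.
rewrite /bary !mxE peval_sum; apply: eq_bigr => j _.
rewrite pevalM !mxE pevalC; congr (_ * _).
case: (splitP j) => k _; rewrite !mxE ?pevalX //.
by rewrite -mpolyC1 pevalC.
Qed.

Lemma peval_bary_shift i y v (h : R) :
  peval (bary x i) (y + h *: v) = peval (bary x i) y + h * bary_slope i v.
Proof.
rewrite !peval_bary /bary_slope.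
have -> : col_mx (const_mx 1 : 'cV_1) (y + h *: v) =
    col_mx (const_mx 1) y + h *: col_mx (0 : 'cV_1) v.
  by rewrite scale_col_mx add_col_mx scaler0 addr0.
by rewrite mulmxDr -scalemxAr !mxE.
Qed.

(** Column [c] of the vertex matrix is [(1, x_c)], so this matrix sends [e_b - e_a] to
    [(0, x_b - x_a)]. Thus only two barycentric coordinates vary along an edge. *)
Lemma bary_slope_edge i a b : bary_slope i (edge x a b) = (i == b)%:R - (i == a)%:R.
Proof.
have colV c : col_mx (const_mx 1 : 'cV_1) (x c) = vertex_mx x *m delta_mx c 0.
  rewrite -colE; apply/colP => r; rewrite /vertex_mx !mxE.
  by case: (splitP r) => k _; rewrite !mxE.
rewrite /bary_slope; have -> : col_mx (0 : 'cV_1) (edge x a b) =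
    vertex_mx x *m (delta_mx b 0 - delta_mx a 0).
  by rewrite mulmxBr -!colV opp_col_mx add_col_mx subrr.
by rewrite mulKmx ?vertex_mx_unit // !mxE !eqxx !andbT.
Qed.

Lemma dderiv_bary i v : dderiv v (bary x i) = mpolyC 3 (bary_slope i v).
Proof.
have dX k : dderiv v (coordX R k 0) = mpolyC 3 (v k 0).
  by rewrite mxE dderivX.
rewrite /bary /bary_slope !mxE dderiv_sum raddf_sum /=.
apply: eq_bigr => j _; rewrite dderivM [X in dderiv v X * _]mxE dderivC mul0r add0r.
rewrite [in RHS]mpolyCM; congr (_ * _); first by rewrite mxE.
rewrite !mxE; case: (splitP j) => k _; rewrite ?dX //.
by rewrite !mxE -mpolyC1 dderivC mpolyC0.
Qed.

(** The weights of a convex combination solve the vertex system, so they are the barycentric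
    coordinates; conversely these coordinates serve as weights. *)
Lemma tetraE : tetra x = [set y | forall i, 0 <= peval (bary x i) (vec3 y)].
Proof.
apply/seteqP; split => y /=.
- move=> [w [w0 w1 wy]] i.
  suff -> : peval (bary x i) (vec3 y) = w i by exact: w0.
  rewrite peval_bary.
  have -> : col_mx (const_mx 1 : 'cV_1) (vec3 y) = vertex_mx x *m \col_j w j.
    rewrite wy; apply/colP => r; rewrite [RHS]mxE.
    case: (split_ordP r) => k ->; rewrite ?col_mxEu ?col_mxEd.
      rewrite mxE -[LHS]w1; apply: eq_bigr => j _.
      by rewrite /vertex_mx col_mxEu !mxE mul1r.
    rewrite summxE; apply: eq_bigr => j _.
    by rewrite /vertex_mx col_mxEd !mxE mulrC.
  by rewrite mulKmx ?vertex_mx_unit // mxE.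
- move=> h; exists (fun i => peval (bary x i) (vec3 y)); split=> //.
    by rewrite -peval_sum sum_bary // -mpolyC1 pevalC.
  have /matrixP e := sum_bary_vertex nd.
  apply/colP => r; have := congr1 (fun q => peval q (vec3 y)) (e r 0).
  rewrite [in RHS]mxE pevalX => <-.
  rewrite !summxE peval_sum; apply: eq_bigr => i _.
  by rewrite !mxE pevalM pevalC.
Qed.

(** Its slope along an edge ending at [x i] is 1. The sum [i + 1] is taken modulo 4 and always names
    another vertex. *)
Lemma bary_eq0F i : bary x i != 0.
Proof.
apply/eqP => b0; have := bary_slope_edge i (i + 1) i.
have i1 : i != i + 1 by rewrite -subr_eq0 opprD addrA subrr sub0r oppr_eq0 oner_eq0.
rewrite eqxx (negPf i1) subr0.
move=> s1; have := dderiv_bary i (edge x (i + 1) i).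
have -> : bary x i = mpolyC 3 0 by rewrite b0 mpolyC0.
by rewrite dderivC => /esym/eqP; rewrite mpolyC_eq0 s1 oner_eq0.
Qed.

Definition open_tetra y := forall i, 0 < peval (bary x i) y.

Lemma open_tetra_open : algebraically_open open_tetra.
Proof.
move=> y v oy.
(* Before parameter [e i], coordinate [i] cannot drop to 0; the summand 1 keeps the denominator
   positive when the slope is 0. *)
pose e i := peval (bary x i) y / (1 + `|bary_slope i v|).
have den i : 0 < 1 + `|bary_slope i v| by rewrite ltr_wpDr.
have e0 i : 0 < e i by rewrite divr_gt0.
exists ((\big[Num.min/1]_i e i) / 2).
  by rewrite divr_gt0 // lt_bigmin ?ltr01.
move=> h /andP[h0 he] i; rewrite peval_bary_shift.
have : h <= e i / 2.
  by apply: (le_trans he); rewrite ler_pM2r ?invr_gt0 //; exact: bigmin_le_cond.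
rewrite ler_pdivlMr // ler_pdivlMr // => hei.
have : - `|bary_slope i v| <= bary_slope i v by rewrite lerNl -normrN ler_norm.
have := oy i; have := normr_ge0 (bary_slope i v); nra.
Qed.

Definition centroid : 'cV[R]_3 := \sum_i 4^-1 *: x i.

Lemma open_tetra_centroid : open_tetra centroid.
Proof.
move=> i; rewrite peval_bary.
have -> : col_mx (const_mx 1 : 'cV_1) centroid = vertex_mx x *m const_mx 4^-1.
  apply/colP => r; rewrite [RHS]mxE.
  case: (split_ordP r) => k ->; rewrite ?col_mxEu ?col_mxEd; last first.
    rewrite summxE; apply: eq_bigr => j _.
    by rewrite /vertex_mx col_mxEd !mxE mulrC.
  under eq_bigr => j _ do rewrite /vertex_mx col_mxEu !mxE mul1r.
  by rewrite mxE sumr_const card_ord; lra.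
by rewrite mulKmx ?vertex_mx_unit // mxE invr_gt0.
Qed.

End BarycentricCoordinates.

(** * Integration over the tetrahedron *)

Section BoundedSupport.
Variable R : realType.
Let T1 := measurableTypeR R.
Let T3 := (T1 * T1 * T1)%type.
Let mu : {measure set T3 -> \bar R} := @lebesgue3 R.

Definition cube (M : R) : set (R * R * R) :=
  (`[- M, M] `*` `[- M, M]) `*` `[- M, M].

Lemma cubeP M y : cube M y <-> box M (vec3 y).
Proof.
split=> [[[/= h1 h2] h3] i|h].
  rewrite !in_itv /= -!ler_norml in h1 h2 h3.
  by rewrite mxE; case: i => [[|[|[|//]]] hi].
split; [split|]; rewrite /= in_itv /= -ler_norml.
- by have := h 0; rewrite mxE.
- by have := h 1; rewrite mxE.
- by have := h 2%:R; rewrite mxE.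
Qed.

Lemma measurable_cube M : measurable (cube M : set T3).
Proof. by apply: measurableX; first exact: measurableX. Qed.

Lemma lebesgue3_cube_fin M : (mu (cube M) < +oo)%E.
Proof.
pose I : set T1 := `[- M, M]%classic.
have mI : measurable I by exact: measurable_itv.
have -> : mu (cube M) = ((@lebesgue_measure R \x @lebesgue_measure R)
    (I `*` I) * @lebesgue_measure R I)%E.
  by apply: product_measure1E => //; exact: measurableX.
have -> : ((@lebesgue_measure R \x @lebesgue_measure R) (I `*` I) =
   @lebesgue_measure R I * @lebesgue_measure R I)%E.
  exact: product_measure1E.
rewrite lebesgue_measure_itv /=.
by case: ifPn => _; rewrite ?mul0e // -EFinB -!EFinM ltry.
Qed.

Lemma integrable_cube_cst M C : mu.-integrable setT (fun y => (C * \1_(cube M) y)%:E).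
Proof.
have mc := measurable_cube M.
have h : mu.-integrable (cube M) (EFin \o cst C).
  by apply: measurable_bounded_integrable => //; 
    [exact: lebesgue3_cube_fin|exists `|C|; split; rewrite ?num_real // => a /ltW ? b _].
move: h => /(integrable_mkcond _ mc).
apply: eq_integrable => // y _; rewrite patchE indicE.
by case: ifPn => _; rewrite ?mulr1 ?mulr0.
Qed.

Lemma integrable_bounded (f : T3 -> R) (M C : R) :
  measurable_fun [set: T3] f -> (forall y, `|f y| <= C * \1_(cube M) y) ->
  mu.-integrable setT (EFin \o f).
Proof.
move=> mf fC.
apply: (@le_integrable _ _ _ mu setT measurableT _ (fun y => (C * \1_(cube M) y)%:E)) => //.
- exact/measurable_EFinP.
- by move=> y _ /=; rewrite lee_fin (le_trans (fC y)) // ler_norm.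
- exact: integrable_cube_cst.
Qed.

(** Dominated convergence for functions supported in one cube. It serves twice: for the translates
    of a face, with [c] the measure of the face, and for difference quotients, with [c = 0]. *)
Lemma integral_cst_limit (f : nat -> T3 -> R) (g : T3 -> R) (M C : R) (c : \bar R) :
  (forall n, measurable_fun [set: T3] (f n)) -> measurable_fun [set: T3] g ->
  (forall n y, `|f n y| <= C * \1_(cube M) y) ->
  {ae mu, forall y, f ^~ y @ \oo --> g y} ->
  (forall n, \int[mu]_y (f n y)%:E = c)%E -> (\int[mu]_y (g y)%:E = c)%E.
Proof.
move=> mf mg fC fg fc.
have [||||//|_ _] := @dominated_convergence _ T3 R mu setT measurableT
  (fun n y => (f n y)%:E) (fun y => (g y)%:E) (fun y => (C * \1_(cube M) y)%:E).
- by move=> n; exact/measurable_EFinP.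
- exact/measurable_EFinP.
- by apply: filterS fg => y fgy _; apply: cvg_EFin => //; exact: nearW.
- exact: integrable_cube_cst.
- by apply: nearW => y n _; rewrite /= lee_fin.
under [X in X @ _ --> _]eq_fun do rewrite fc.
by move=> /(cvg_lim (@ereal_hausdorff R)); rewrite lim_cst // => ->.
Qed.

Lemma cvg_of_le_inv (u : nat -> R) (l C : R) (N : nat) :
  (forall n, (N <= n)%N -> `|u n - l| <= C * n.+1%:R^-1) -> u @ \oo --> l.
Proof.
move=> h; apply/subr_cvg0/norm_cvg0P.
apply: (@squeeze_cvgr _ _ _ _ (fun=> 0) (fun n => C * n.+1%:R^-1)).
- by exists N => // n /= Nn; rewrite normr_ge0 h.
- exact: cvg_cst.
- rewrite -(mulr0 C); apply: cvgMr; exact: cvg_harmonic.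
Qed.

End BoundedSupport.

(** * The integral of polynomials over the tetrahedron: linearity and definiteness *)

Section IntegralOnTetrahedron.
Variables (R : realType) (x : 'I_4 -> 'cV[R]_3).
Hypothesis nd : nondegenerate_tetra x.
Let T1 := measurableTypeR R.
Let T3 := (T1 * T1 * T1)%type.
Let mu : {measure set T3 -> \bar R} := @lebesgue3 R.
Let K : set T3 := tetra x.
Implicit Types (q : poly3 R) (y : R * R * R).

Lemma measurable_peval q : measurable_fun [set: T3] (fun y : T3 => peval q (vec3 y)).
Proof.
elim/mpoly_ring_ind: q => [c|i|p q mp mq|p q mp mq].
- by under eq_fun do rewrite pevalC; exact: measurable_cst.
- under eq_fun do rewrite pevalX mxE.
  case: i => [[|[|[|//]]] hi] /=.
  + exact: (measurableT_comp measurable_fst measurable_fst).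
  + exact: (measurableT_comp measurable_snd measurable_fst).
  + exact: measurable_snd.
- by under eq_fun do rewrite pevalD; exact: measurable_funD.
- by under eq_fun do rewrite pevalM; exact: measurable_funM.
Qed.

Lemma measurable_tetra : measurable K.
Proof.
rewrite /K tetraE //.
rewrite (_ : [set y | _] = \bigcap_(i in [set: 'I_4])
   (fun y : T3 => peval (bary x i) (vec3 y)) @^-1` `[0, +oo[%classic).
  apply: fin_bigcap_measurable => // i _.
  by rewrite -[X in measurable X]setTI; apply: measurable_peval.
by apply/seteqP; split=> y h i; have := h i; rewrite /= in_itv /= andbT; auto.
Qed.

Definition tetra_radius : R := \sum_i \sum_r `|x i r 0|.

Lemma tetra_box y : tetra x y -> box tetra_radius (vec3 y).
Proof.
move=> [w [w0 w1 ->]] r; rewrite summxE (le_trans (ler_norm_sum _ _ _)) //.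
apply: ler_sum => i _; rewrite mxE normrM.
have wi : `|w i| <= 1.
  by rewrite ger0_norm // -w1 (bigD1 i) //= lerDl sumr_ge0.
rewrite (le_trans (ler_wpM2r _ wi)) // mul1r.
by rewrite (bigD1 r) //= lerDl sumr_ge0.
Qed.

Lemma integrable_peval q : mu.-integrable K (fun y => (peval q (vec3 y))%:E).
Proof.
apply/(integrable_mkcond _ measurable_tetra).
have [C hC] := box_bounded_peval tetra_radius q.
rewrite (_ : _ \_ _ = EFin \o (fun y : T3 => peval q (vec3 y) * \1_K y)); last first.
  apply/funext => y; rewrite patchE /= indicE.
  by case: ifP => _; rewrite ?mulr1 ?mulr0.
apply: (@integrable_bounded _ _ tetra_radius `|C|).
  apply: measurable_funM; first exact: measurable_peval.
  exact: measurable_indic measurable_tetra.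
move=> y; rewrite !indicE normrM.
have [yK|yK] := boolP (y \in K); last first.
  by rewrite normr0 mulr0 mulr_ge0.
have by_ : cube tetra_radius y by apply/cubeP/tetra_box/set_mem.
rewrite mem_set // normr1 !mulr1 (le_trans _ (ler_norm C)) //.
by apply: (hC _ 0); rewrite ?normr0 //; exact/cubeP.
Qed.

Definition tetra_int q : R := \int[mu]_(y in K) peval q (vec3 y).

Lemma tetra_intE q : (\int[mu]_(y in K) (peval q (vec3 y))%:E)%E = (tetra_int q)%:E.
Proof.
rewrite /tetra_int /Rintegral fineK //.
exact: (integrable_fin_num measurable_tetra (integrable_peval q)).
Qed.

Lemma tetra_intD p q : tetra_int (p + q) = tetra_int p + tetra_int q.
Proof.
rewrite /tetra_int -RintegralD; try exact: integrable_peval; last exact: measurable_tetra.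
by apply: eq_Rintegral => y _; rewrite pevalD.
Qed.

Lemma tetra_intZ c q : tetra_int (c *: q) = c * tetra_int q.
Proof.
rewrite /tetra_int -RintegralZl; try exact: integrable_peval; last exact: measurable_tetra.
by apply: eq_Rintegral => y _; rewrite pevalZ.
Qed.

(** A neighbourhood in the product topology contains a product of three intervals, whose measure is
    the product of their lengths. *)
Lemma open_box_positive_measure (U : set (R * R * R)) y :
  open U -> U y -> exists2 A : set T3, A `<=` U & measurable A /\ (0 < mu A)%E.
Proof.
move=> oU Uy; have := open_nbhs_nbhs (conj oU Uy).
move=> [[P Q] /= [[[P1 P2] /= [nP1 nP2] sP] nQ] sU].
have [e1 /= e10 h1] := (proj1 (nbhs_ballP _ _) nP1).
have [e2 /= e20 h2] := (proj1 (nbhs_ballP _ _) nP2).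
have [e3 /= e30 h3] := (proj1 (nbhs_ballP _ _) nQ).
have mb z e : measurable (ball z e : set T1) by exact: measurable_ball.
have pb (z e : R) : 0 < e -> (0 < @lebesgue_measure R (ball z e))%E.
  by move=> e0; rewrite lebesgue_measure_ball ?ltW // lte_fin mulrn_wgt0.
exists ((ball y.1.1 e1 `*` ball y.1.2 e2) `*` ball y.2 e3).
  move=> z [[/= z1 z2] z3]; apply: (sU z); split => /=.
    by apply: sP; split; [exact: h1|exact: h2].
  exact: h3.
split; first by apply: measurableX => //; exact: measurableX.
have -> : mu ((ball y.1.1 e1 `*` ball y.1.2 e2) `*` ball y.2 e3) =
  ((@lebesgue_measure R \x @lebesgue_measure R)
    (ball y.1.1 e1 `*` ball y.1.2 e2) * @lebesgue_measure R (ball y.2 e3))%E.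
  by apply: product_measure1E => //; exact: measurableX.
have -> : ((@lebesgue_measure R \x @lebesgue_measure R)
    (ball y.1.1 e1 `*` ball y.1.2 e2) =
   @lebesgue_measure R (ball y.1.1 e1) * @lebesgue_measure R (ball y.1.2 e2))%E.
  exact: product_measure1E.
by rewrite !mule_gt0 ?pb.
Qed.

Lemma continuous_peval q : continuous (fun y : R * R * R => peval q (vec3 y)).
Proof.
elim/mpoly_ring_ind: q => [c|i|p q mp mq|p q mp mq] y.
- by under eq_fun do rewrite pevalC; exact: cvg_cst.
- under eq_fun do rewrite pevalX mxE.
  case: i => [[|[|[|//]]] hi] /=.
  + by apply: (@cvg_comp _ _ _ fst fst); exact: cvg_fst.
  + by apply: (@cvg_comp _ _ _ fst snd); [exact: cvg_fst|exact: cvg_snd].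
  + exact: cvg_snd.
- by under eq_fun do rewrite pevalD; apply: cvgD; [exact: mp|exact: mq].
- by under eq_fun do rewrite pevalM; apply: cvgM; [exact: mp|exact: mq].
Qed.

Lemma open_peval_gt0 q : open [set y : R * R * R | 0 < peval q (vec3 y)].
Proof.
have := @open_gt R 0; move: (@continuous_peval q).
by move=> /continuousP h /h.
Qed.

Lemma vec3K (v : 'cV[R]_3) : vec3 ((v 0 0, v 1 0), v 2%:R 0) = v.
Proof.
apply/colP => i; rewrite !mxE.
by case: i => [[|[|[|//]]] hi] /=; congr (v _ _); apply: val_inj.
Qed.

(** Were [q] positive at an interior point, it would be positive on an open part of the tetrahedron,
    which has positive measure, whereas a zero integral makes [q] vanish almost everywhere. So [q]
    vanishes on the open tetrahedron, hence formally. *)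
Lemma tetra_int_eq0 q : (forall v, (forall i, 0 <= peval (bary x i) v) -> 0 <= peval q v) ->
  tetra_int q = 0 -> q = 0.
Proof.
move=> q0 Iq.
apply: (@poly_eq0_open R (open_tetra x) q (centroid x)) => [||v ov].
- exact: open_tetra_open.
- exact: open_tetra_centroid.
have qv : 0 <= peval q v by apply: q0 => i; exact: ltW.
apply/eqP; rewrite eq_le qv andbT leNgt; apply/negP => qv0.
pose y0 : R * R * R := ((v 0 0, v 1 0), v 2%:R 0).
pose U := [set y : R * R * R | forall i, 0 < peval (bary x i) (vec3 y)]
  `&` [set y | 0 < peval q (vec3 y)].
have oU : open U.
  apply: openI; last exact: open_peval_gt0.
  rewrite openE => y Uy; 
  apply: (@filter_forall _ _ (fun i => [set y | 0 < peval (bary x i) (vec3 y)]) (nbhs y)) => i.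
  by apply: open_nbhs_nbhs; split; [exact: open_peval_gt0|exact: Uy].
have Uy0 : U y0.
  by split; [move=> i|]; rewrite /= vec3K.
have [A AU [mA A0]] := open_box_positive_measure oU Uy0.
have AK : A `<=` K.
  by move=> z /AU [hz _]; rewrite /K tetraE // => i; exact/ltW/hz.
have mq : measurable_fun K (fun y : T3 => (peval q (vec3 y))%:E).
  apply: measurable_funS (measurableT) _ _ => //; apply/measurable_EFinP.
  exact: measurable_peval.
have : (\int[mu]_(y in K) `|(peval q (vec3 y))%:E| = 0)%E.
  transitivity (\int[mu]_(y in K) (peval q (vec3 y))%:E)%E; last first.
    by rewrite tetra_intE Iq.
  apply: eq_integral => y /set_mem yK; rewrite gee0_abs // lee_fin.
  by apply: q0 => i; move: yK; rewrite /K tetraE.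
move=> /(ae_eq_integral_abs mu measurable_tetra mq) [N [mN N0 KN]].
move: A0; rewrite ltNge => /negP; apply.
rewrite -N0; apply: le_measure; rewrite ?inE // => z Az; apply: KN => /=.
move=> /(_ (AK z Az)) [] /eqP; apply/negP; rewrite gt_eqF //.
by have [_] := AU z Az.
Qed.

(** * Integration by parts along one edge *)

Section Stokes.
Variables a b : 'I_4.
Hypothesis ab : a != b.
Let t := edge x a b.
Let lam (i : 'I_4) (y : R * R * R) := peval (bary x i) (vec3 y).
Let step (n : nat) : R := n.+1%:R^-1.
Let s (n : nat) (y : R * R * R) : R * R * R := shift3 (step n *: t) y.
Let rad := tetra_radius + \sum_r `|t r 0|.

Let step_gt0 n : 0 < step n.
Proof. by rewrite invr_gt0. Qed.

Let step_le1 n : step n <= 1.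
Proof. by rewrite invf_le1 // ler1n. Qed.

Let step_lt e : 0 < e -> exists N, forall n, (N <= n)%N -> step n < e.
Proof.
move=> e0; have [N _ hN] := cvgr0_norm_lt _ (@cvg_harmonic R) _ e0.
by exists N => n /hN; rewrite /= gtr0_norm // /harmonic /= invr_gt0.
Qed.

Let vec3_s n y : vec3 (s n y) = vec3 y + step n *: t.
Proof. exact: vec3_shift. Qed.

Let lam_s n y i : lam i (s n y) = lam i y + step n * ((i == b)%:R - (i == a)%:R).
Proof. by rewrite /lam vec3_s peval_bary_shift bary_slope_edge. Qed.

Let measurable_s n : measurable_fun [set: T3] (s n : T3 -> T3).
Proof. exact: measurable_shift3. Qed.

Let integral_s n (f : T3 -> R) : measurable_fun [set: T3] f ->
  (\int[mu]_y (f (s n y))%:E = \int[mu]_y (f y)%:E)%E.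
Proof.
move=> mf.
have mf' : measurable_fun [set: T3] (EFin \o f) by exact/measurable_EFinP.
have := integral_preserving (mu := mu) (@measurable_s n) (@lebesgue3_shift R (step n *: t)) mf'.
exact.
Qed.

Let tetraP y : reflect (forall i, 0 <= lam i y) (y \in K).
Proof. by apply: (iffP idP); rewrite inE /K tetraE. Qed.

Let box_tetra y : y \in K -> cube rad y.
Proof.
move=> /set_mem /tetra_box h; apply/cubeP => r.
by rewrite (le_trans (h r)) // lerDl sumr_ge0.
Qed.

Let box_tetra_s n y : s n y \in K -> cube rad y.
Proof.
move=> /set_mem /tetra_box h; apply/cubeP => r; have := h r.
have -> : vec3 (s n y) r 0 = vec3 y r 0 + step n * t r 0.
  by rewrite vec3_s mxE; congr (_ + _); rewrite mxE.
move=> hr.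
have st : `|step n * t r 0| <= \sum_r `|t r 0|.
  rewrite normrM gtr0_norm // (le_trans (ler_wpM2r _ (step_le1 n))) //.
  by rewrite mul1r (bigD1 r) //= lerDl sumr_ge0.
rewrite -[X in `|X|](addrK (step n * t r 0)) (le_trans (ler_normB _ _)) //.
exact: lerD.
Qed.

(** A shift raises no coordinate by more than [step n], so a negative coordinate stays negative for
    large [n]. *)
Let notin_s y : y \notin K -> exists N, forall n, (N <= n)%N -> s n y \notin K.
Proof.
move=> yK; have [i li] : exists i, lam i y < 0.
  have /existsNP[i hi] : ~ forall i, 0 <= lam i y by move/tetraP; apply/negP.
  by exists i; rewrite ltNge; apply/negP.
have l0 : 0 < - lam i y by rewrite oppr_gt0.
have [N hN] := step_lt l0; exists N => n /hN hn.
apply/tetraP => /(_ i); rewrite lam_s.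
have := step_gt0 n; case: (i == b); case: (i == a) => /=; lra.
Qed.

(** Only coordinate [a] decreases, and by [step n]. *)
Let in_s y : y \in K -> 0 < lam a y -> exists N, forall n, (N <= n)%N -> s n y \in K.
Proof.
move=> /tetraP yK la.
have [N hN] := step_lt la; exists N => n /hN hn.
apply/tetraP => i; rewrite lam_s; have := yK i; have := step_gt0 n.
by have [->|ia] := eqVneq i a; [rewrite (negPf ab)|case: (i == b)] => /=; lra.
Qed.

(** The face opposite to [x a], which every shift along [t] leaves at once. Everywhere else
    [notin_s] and [in_s] settle the position of [s n y] for large [n]. *)
Let face : set T3 := K `&` [set y | lam a y = 0].

Let measurable_face : measurable face.
Proof.
apply: measurableI; first exact: measurable_tetra.
rewrite (_ : [set y | _] = (lam a : T3 -> R) @^-1` [set 0]).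
  by rewrite -[X in measurable X]setTI; apply: measurable_peval.
by apply/seteqP; split.
Qed.

(* Each point lies in at most one of the translates of the face along [t], so that
   their indicators tend to 0, whereas their integrals are all equal. *)
Let face_null : mu face = 0.
Proof.
suff <- : (\int[mu]_y ((cst 0 : T3 -> R) y)%:E = mu face)%E by rewrite integral0.
apply: (@integral_cst_limit R (fun n y => \1_face (s n y)) (cst 0) rad 1).
- move=> n; have m1 : measurable_fun [set: T3] (\1_face : T3 -> R).
    exact: measurable_indic measurable_face.
  by apply: (measurableT_comp m1); exact: measurable_s.
- exact: measurable_cst.
- move=> n y; rewrite mul1r !indicE.
  have [/set_mem [yK _]|_] := boolP (s n y \in face); last by rewrite normr0.
  by rewrite normr1 mem_set //; apply: (box_tetra_s (n := n)); exact: mem_set.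
- apply: nearW => y.
  have [N hN] : exists N, forall n, (N <= n)%N -> s n y \notin face.
    have [la|la] := ltP (lam a y) 0.
      exists 0%N => n _; apply/negP => /set_mem [_] /=.
      by rewrite lam_s eqxx (negPf ab) /=; have := step_gt0 n; lra.
    have [la0|la0] := eqVneq (lam a y) 0.
      exists 0%N => n _; apply/negP => /set_mem [_] /=.
      by rewrite lam_s eqxx (negPf ab) /=; have := step_gt0 n; lra.
    have lgt : 0 < lam a y by rewrite lt_neqAle eq_sym la0.
    have [N hN] := step_lt lgt; exists N => n /hN hn; apply/negP => /set_mem [_] /=.
    by rewrite lam_s eqxx (negPf ab) /=; lra.
  apply: (@cvg_of_le_inv _ _ _ 0 N) => n /hN /negPf sF.
  by rewrite indicE sF subrr normr0 mul0r.
- move=> n; rewrite integral_s; last exact: measurable_indic.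
  by rewrite integral_indic // setIT.
Qed.

Lemma tetra_int_dderiv_bubble q :
  tetra_int (dderiv t (bary x a * bary x b * q)) = 0.
Proof.
set f := _ * q.
pose g (y : T3) : R := peval f (vec3 y) * \1_K y.
pose D n (y : T3) : R := n.+1%:R * (g (s n y) - g y).
have mK : measurable_fun [set: T3] (\1_K : T3 -> R).
  exact: measurable_indic measurable_tetra.
have mg : measurable_fun [set: T3] g.
  by apply: measurable_funM => //; exact: measurable_peval.
have mgs n : measurable_fun [set: T3] (fun y => g (s n y)).
  by apply: (measurableT_comp mg); exact: measurable_s.
have [r [[Cr hr] fr]] := peval_taylor rad t f.
have [Cd hd] := box_bounded_peval rad (dderiv t f).
have [C1 h1] := box_bounded_peval rad (bary x b * q).
have [C2 h2] := box_bounded_peval rad (bary x a * q).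
have [Cf hf] := box_bounded_peval rad f.
have cb y : cube rad y -> box rad (vec3 y) by move/cubeP.
(* [Cr] and [Cd] serve when [y] and [s n y] both lie in [K], [C2] when only [s n y] does, [C1] when
   only [y] does. *)
pose C := `|Cr| + `|Cd| + `|C1| + `|C2|.
have step_norm n : `|step n| <= 1 by rewrite gtr0_norm.
have Dr n y : y \in K -> s n y \in K ->
    D n y = peval (dderiv t f) (vec3 y) + step n * r (vec3 y) (step n).
  move=> yK sK; rewrite /D /g !indicE yK sK !mulr1 vec3_s fr.
  have : n.+1%:R * step n = 1 by rewrite divff ?pnatr_eq0.
  move=> mh; transitivity ((n.+1%:R * step n) *
    (peval (dderiv t f) (vec3 y) + step n * r (vec3 y) (step n))).
    by ring.
  by rewrite mh mul1r.
(* When only one of [y] and [s n y] lies in [K], that point is at barycentric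
   distance at most [step n] from a face on which [f] vanishes. *)
have D_small n y (A B E : R) : g (s n y) - g y = A * B -> 0 <= A <= step n ->
    `|B| <= E -> `|E| <= C -> `|D n y| <= C.
  rewrite /D => -> /andP[A0 An] BE EC; rewrite !normrM ger0_norm // (ger0_norm A0).
  rewrite mulrA (le_trans _ EC) // (le_trans _ (ler_norm E)) // (le_trans _ BE) //.
  by rewrite ler_piMl // -ler_pdivlMl // mulr1.
have DC n y : `|D n y| <= C * \1_(cube rad) y.
  rewrite indicE.
  have [sK|sK] := boolP (s n y \in K); have [yK|yK] := boolP (y \in K).
  - rewrite (mem_set (box_tetra yK)) /= mulr1 Dr // (le_trans (ler_normD _ _)) //.
    have := hd _ 0 (cb _ (box_tetra yK)); rewrite normr0 => /(_ ler01) hd1.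
    have := hr _ (step n) (cb _ (box_tetra yK)) (step_norm n) => hr1.
    have : `|step n * r (vec3 y) (step n)| <= Cr.
      rewrite normrM gtr0_norm // (le_trans _ hr1) // ler_piMl //.
    rewrite /C; have := ler_norm Cr; have := ler_norm Cd.
    by have := normr_ge0 C1; have := normr_ge0 C2; lra.
  - have bs : box rad (vec3 (s n y)) by exact/cb/box_tetra.
    rewrite (mem_set (box_tetra_s sK)) /= mulr1.
    (* Going back from [s n y] to [y] lowers coordinate [b] alone, by [step n]; as this leaves [K],
       that coordinate was at most [step n]. The next case is symmetric, with [a] in place of
       [b]. *)
    have lb : 0 <= lam b (s n y) <= step n.
      have /tetraP sK' := sK; rewrite sK' /= leNgt; apply/negP => lb.
      move/negP: yK; apply; apply/tetraP => i.
      have := sK' i; have := step_gt0 n; rewrite lam_s.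
      move: lb; rewrite lam_s eqxx (eq_sym b) (negPf ab).
      have [ib|ib] := eqVneq i b; have [ia|ia] := eqVneq i a; rewrite ?ib /=; lra.
    apply: (D_small _ _ (lam b (s n y)) (peval (bary x a * q) (vec3 (s n y))) C2 _ lb).
    + rewrite /g !indicE sK (negPf yK) /= mulr1 mulr0 subr0 /f /lam !pevalM; ring.
    + by apply: (h2 _ 0); rewrite ?normr0.
    + by rewrite /C lerDr !addr_ge0.
  - have by_ : box rad (vec3 y) by exact/cb/box_tetra.
    rewrite (mem_set (box_tetra yK)) /= mulr1.
    have la : 0 <= lam a y <= step n.
      have /tetraP yK' := yK; rewrite yK' /= leNgt; apply/negP => la.
      move/negP: sK; apply; apply/tetraP => i.
      have := yK' i; have := step_gt0 n; rewrite lam_s.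
      have [ib|ib] := eqVneq i b; have [ia|ia] := eqVneq i a; rewrite ?ia /=; lra.
    apply: (D_small _ _ (lam a y) (- peval (bary x b * q) (vec3 y)) C1 _ la).
    + rewrite /g !indicE yK (negPf sK) /= mulr1 mulr0 sub0r /f /lam !pevalM; ring.
    + by rewrite normrN; apply: (h1 _ 0); rewrite ?normr0.
    + by rewrite /C; have := normr_ge0 Cr; have := normr_ge0 Cd; have := normr_ge0 C2; lra.
  - by rewrite /D /g !indicE (negPf sK) (negPf yK) !mulr0 subrr mulr0 normr0 mulr_ge0 // /C !addr_ge0.
have gint : mu.-integrable setT (EFin \o g).
  apply: (@integrable_bounded _ g rad `|Cf|) => // y.
  rewrite /g !indicE; have [yK|yK] := boolP (y \in K).
    rewrite (mem_set (box_tetra yK)) /= !mulr1 (le_trans (hf _ 0 _ _)) ?normr0 ?ler_norm //.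
    exact/cb/box_tetra.
  by rewrite mulr0 normr0 mulr_ge0.
have gsint n : mu.-integrable setT (EFin \o (fun y => g (s n y))).
  apply: (@integrable_bounded _ _ rad `|Cf|) => // y.
  rewrite /g !indicE; have [sK|sK] := boolP (s n y \in K).
    rewrite (mem_set (box_tetra_s sK)) /= !mulr1 (le_trans (hf _ 0 _ _)) ?normr0 ?ler_norm //.
    exact/cb/box_tetra.
  by rewrite mulr0 normr0 mulr_ge0.
have intD n : (\int[mu]_y (D n y)%:E = 0)%E.
  transitivity (\int[mu]_y (n.+1%:R%:E * ((g (s n y))%:E - (g y)%:E)))%E.
    by apply: eq_integral => y _; rewrite /D EFinM EFinB.
  rewrite integralZl //; last exact: (integrableB measurableT (gsint n) gint).
  rewrite (integralB measurableT (gsint n) gint).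
  rewrite integral_s // subee ?mule0 //.
  exact: (integrable_fin_num measurableT gint).
(* The exceptional set is [face]. Off it, [y] and [s n y] are for large [n] both outside [K], or
   both inside with an error of [step n] times the Taylor remainder. *)
have lim : {ae mu, forall y, D ^~ y @ \oo --> peval (dderiv t f) (vec3 y) * \1_K y}.
  exists face; split=> [||y /= ny]; [exact: measurable_face|exact: face_null|].
  apply: contrapT => yF; apply: ny.
  have [yK|yK] := boolP (y \in K); last first.
    have [N hN] := notin_s yK.
    apply: (@cvg_of_le_inv _ _ _ 0 N) => n /hN sK.
    rewrite /D /g !indicE (negPf sK) (negPf yK) !mulr0 !subrr mulr0 subr0 normr0.
    by rewrite mul0r.
  have la : 0 < lam a y.
    rewrite lt_neqAle; have /tetraP -> := yK; rewrite andbT.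
    by apply/eqP => la; apply: yF; split=> //; exact: set_mem.
  have [N hN] := in_s yK la.
  apply: (@cvg_of_le_inv _ _ _ Cr N) => n /hN sK.
  rewrite Dr // indicE yK mulr1 addrC addKr normrM gtr0_norm // mulrC.
  apply: ler_wpM2r; first exact: (ltW (step_gt0 n)).
  by apply: hr => //; exact/cb/box_tetra.
have mD n : measurable_fun [set: T3] (D n).
  by apply: measurable_funM => //; apply: measurable_funB.
have mG : measurable_fun [set: T3] (fun y => peval (dderiv t f) (vec3 y) * \1_K y).
  by apply: measurable_funM => //; exact: measurable_peval.
have := integral_cst_limit mD mG DC lim intD.
rewrite /tetra_int /Rintegral integral_mkcond => I0.
rewrite (_ : integral _ _ _ = 0%E) //; rewrite -[RHS]I0.
apply: eq_integral => y _; rewrite patchE /= indicE.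
by case: ifP => _; rewrite ?mulr1 ?mulr0.
Qed.

End Stokes.

End IntegralOnTetrahedron.

(** * Symmetric gradients and rigid motions *)

Section OrthogonalProjection.
Variables (F : fieldType) (V : zmodType) (sc : F -> V -> V) (B : V -> V -> F).

(* [sc] is a bare function, so that it can be the action of the reals on vectors
   of polynomials, which are canonically a module over the polynomials only. *)
Definition closed_span (W : V -> Prop) :=
  [/\ W 0, forall u v, W u -> W v -> W (u - v) & forall c u, W u -> W (sc c u)].

(** The span as an intersection of closed subsets, which avoids coefficients. [W] is later taken to
    be the orthogonal complement of a vector, or the set of divergences. *)
Definition in_span (s : seq V) (w : V) :=
  forall W, closed_span W -> (forall g, g \in s -> W g) -> W w.

Hypothesis BB : forall u v w, B (u - v) w = B u w - B v w.
Hypothesis Bsc : forall c u w, B (sc c u) w = c * B u w.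
Hypothesis Bsym : forall u v, B u v = B v u.
Hypothesis Bdef : forall u, B u u = 0 -> u = 0.

Lemma orthogonal_span s z w :
  (forall g, g \in s -> B z g = 0) -> in_span s w -> B z w = 0.
Proof.
move=> zs ws; apply: (ws (fun w => B z w = 0)) => //; split.
- by rewrite Bsym -(subrr z) BB subrr.
- by move=> u v u0 v0; rewrite Bsym BB !(Bsym _ z) u0 v0 subrr.
- by move=> c u u0; rewrite Bsym Bsc Bsym u0 mulr0.
Qed.

(** Gram-Schmidt by induction on [s]: a new generator [g] is replaced by its residual [u] after
    projection onto the earlier ones. *)
Lemma orthogonal_projection s v :
  exists2 w, in_span s w & forall g, g \in s -> B (v - w) g = 0.
Proof.
elim: s v => [|g s IH] v; first by exists 0 => // W [].
have sub w : in_span s w -> in_span (g :: s) w.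
  by move=> ws W cW gW; apply: ws => // h hs; apply: gW; rewrite inE hs orbT.
have [w1 ww1 hw1] := IH v; have [wg wwg hwg] := IH g.
set u := g - wg in hwg.
have gE z : B z g = B z u + B z wg.
  by rewrite (Bsym z u) /u BB (Bsym g) (Bsym wg) subrK.
have [/Bdef u0|u0] := eqVneq (B u u) 0.
  exists w1; first exact: sub.
  move=> h; rewrite inE => /predU1P[->|/hw1 //].
  rewrite gE (orthogonal_span hw1 wwg) u0 addr0.
  by rewrite Bsym -(subrr v) BB subrr.
(* The Gram-Schmidt coefficient. The projection is [w1 + c u], written as a difference because
   [closed_span] speaks of differences. *)
pose c := B (v - w1) u / B u u.
exists (w1 - sc (- c) u).
  move=> W cW gW; have [_ WB Wsc] := cW.
  apply: (WB); first exact: sub.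
  by apply/Wsc/WB; [apply: gW; exact: mem_head|exact: sub].
have E h : B (v - (w1 - sc (- c) u)) h = B (v - w1) h - c * B u h.
  by rewrite BB (BB w1) Bsc (BB v w1); ring.
have vs h : h \in s -> B (v - (w1 - sc (- c) u)) h = 0.
  by move=> hs; rewrite E hw1 // hwg // mulr0 subrr.
move=> h; rewrite inE => /predU1P[->|/vs //].
by rewrite gE (orthogonal_span vs wwg) addr0 E /c divfK // subrr.
Qed.

End OrthogonalProjection.

Lemma big_ord3 (V : nmodType) (F : 'I_3 -> V) : \sum_j F j = F 0 + F 1 + F 2%:R.
Proof.
rewrite !big_ord_recl big_ord0 addr0 addrA.
by congr (F _ + F _ + F _); exact: val_inj.
Qed.

(** * Strain along a direction, its polarization, and the kernel of the symmetric gradient *)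

Section Strain.
Variable R : realType.
Implicit Types (u w : 'cV[poly3 R]_3) (t v : 'cV[R]_3) (p f : poly3 R).

Definition tdot t u : poly3 R := \sum_(i < 3) t i 0 *: u i 0.

(* The quadratic form [t^T eps(u) t] of the symmetric gradient [eps(u)]. *)
Definition strain t u : poly3 R := dderiv t (tdot t u).

(** The bilinear form [2 t^T eps(u) v]; the factor 2 spares the halves in [eps(u)]. *)
Definition strain_polar t v u : poly3 R :=
  \sum_(i < 3) \sum_(j < 3) (t i 0 * v j 0) *: (mderiv j (u i 0) + mderiv i (u j 0)).

Lemma strain_polarC t v u : strain_polar t v u = strain_polar v t u.
Proof.
rewrite /strain_polar exchange_big; apply: eq_bigr => i _; apply: eq_bigr => j _.
by rewrite mulrC addrC.
Qed.

Lemma strain_polarDl t t' v u :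
  strain_polar (t + t') v u = strain_polar t v u + strain_polar t' v u.
Proof.
rewrite -big_split; apply: eq_bigr => i _; rewrite -big_split; apply: eq_bigr => j _.
by rewrite mxE mulrDl scalerDl.
Qed.

Lemma strain_polarZl c t v u : strain_polar (c *: t) v u = c *: strain_polar t v u.
Proof.
rewrite scaler_sumr; apply: eq_bigr => i _; rewrite scaler_sumr; apply: eq_bigr => j _.
by rewrite mxE -mulrA scalerA.
Qed.

Lemma strain_polar_suml (I : finType) (c : I -> R) (t : I -> 'cV[R]_3) v u :
  strain_polar (\sum_i c i *: t i) v u = \sum_i c i *: strain_polar (t i) v u.
Proof.
under [RHS]eq_bigr do rewrite -strain_polarZl.
apply: (big_morph (fun t => strain_polar t v u)) => [a b|].
  exact: strain_polarDl.
by rewrite -(scale0r 0) strain_polarZl scale0r.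
Qed.

Lemma strain_polar_diag t u : strain_polar t t u = 2 *: strain t u.
Proof.
have -> : strain t u = \sum_(i < 3) \sum_(j < 3) (t i 0 * t j 0) *: mderiv j (u i 0).
  rewrite /strain /tdot dderiv_sum; apply: eq_bigr => i _.
  rewrite dderivZ scaler_sumr; apply: eq_bigr => j _.
  by rewrite scalerA.
rewrite scaler_nat mulr2n.
rewrite [X in _ = X + _]exchange_big -big_split; apply: eq_bigr => i _.
rewrite -big_split; apply: eq_bigr => j _.
by rewrite /= scalerDr addrC (mulrC (t j 0)).
Qed.

Lemma strain_polar_delta i j u :
  strain_polar (delta_mx i 0) (delta_mx j 0) u = mderiv j (u i 0) + mderiv i (u j 0).
Proof.
rewrite /strain_polar (bigD1 i) //= [X in _ + X]big1 => [|k ki]; last first.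
  by rewrite big1 // => l _; rewrite mxE (negPf ki) mul0r scale0r.
rewrite addr0 (bigD1 j) //= [X in _ + X]big1 => [|k kj]; last first.
  by rewrite [X in _ * X]mxE (negPf kj) mulr0 scale0r.
by rewrite !mxE !eqxx mulr1 scale1r addr0.
Qed.

(** The linear part of a rigid motion is a skew matrix [S], and [t^T S t = 0]. *)
Lemma strain_rigid t u : rigid_motions u -> strain t u = 0.
Proof.
move=> [a1 [a2 [a3 [a4 [a5 [a6 ->]]]]]].
rewrite /strain /tdot big_ord3 !mxE /=.
rewrite !mul_mpolyC !(dderivD, dderivN, dderivZ, dderivC, dderivX) -!mul_mpolyC.
ring.
Qed.

(** The second derivatives are symmetric in the two differentiation indices and skew in the inner
    one and the component index, which forces them to vanish. So the gradient is a constant skew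
    matrix and [u] is affine. *)
Lemma rigid_of_symmetric_gradient u :
  (forall i j, mderiv j (u i 0) + mderiv i (u j 0) = 0) -> rigid_motions u.
Proof.
move=> sk.
have sw i j : mderiv j (u i 0) = - mderiv i (u j 0) by apply/eqP; rewrite -addr_eq0 sk.
have dd k i j : mderiv k (mderiv j (u i 0)) = 0.
  set D := fun k j i => mderiv k (mderiv j (u i 0)).
  have Dc a b c : D a b c = D b a c by exact: mderiv_comm.
  have Da a b c : D a b c = - D a c b by rewrite /D sw mderivN.
  have : D k j i = - D k j i.
    by rewrite {1}Dc Da Dc Da opprK Dc Da Dc -/(D k j i).
  move/eqP; rewrite -addr_eq0 -mulr2n -scaler_nat scaler_eq0 pnatr_eq0 /=.
  by move/eqP.
pose A i j := mcoeff mnm0 (mderiv j (u i 0)).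
have eA i j : mderiv j (u i 0) = mpolyC 3 (A i j).
  by apply: mderiv_eq0_const => k; exact: dd.
have As i j : A i j = - A j i by rewrite /A sw mcoeffN.
have Ad i : A i i = 0 by have := As i i; lra.
have uE i : exists c, u i 0 = mpolyC 3 c + \sum_j mpolyC 3 (A i j) * mpolyX R (mnm1 j).
  pose q := u i 0 - \sum_j mpolyC 3 (A i j) * mpolyX R (mnm1 j).
  exists (mcoeff mnm0 q); rewrite -(mderiv_eq0_const (p := q)) ?subrK //.
  move=> k; rewrite mderivB eA -dderiv_delta dderiv_sum.
  under eq_bigr => j _ do rewrite mul_mpolyC dderivZ dderivX -mul_mpolyC mxE eqxx andbT.
  rewrite (bigD1 k) //= big1 => [|j jk]; last by rewrite (negPf jk) mpolyC0 mulr0.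
  by rewrite eqxx mpolyC1 mulr1 addr0 subrr.
have [c0 h0] := uE 0; have [c1 h1] := uE 1; have [c2 h2] := uE 2%:R.
exists c0, c1, c2, (A 1 0), (A 2%:R 0), (A 2%:R 1) => /=.
rewrite !big_ord3 !Ad mpolyC0 in h0 h1 h2.
rewrite (As 0 1) (As 0 2%:R) !mpolyCN in h0; rewrite (As 1 2%:R) mpolyCN in h1.
apply/colP => i; rewrite !mxE.
case: i => [[|[|[|//]]] hi] /=.
- by rewrite (_ : Ordinal hi = 0) ?h0; [ring|exact: val_inj].
- by rewrite (_ : Ordinal hi = 1) ?h1; [ring|exact: val_inj].
- by rewrite (_ : Ordinal hi = 2%:R) ?h2; [ring|exact: val_inj].
Qed.

End Strain.

(** * Divergences of edge bubbles *)

Section Bubbles.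
Variables (R : realType) (x : 'I_4 -> 'cV[R]_3).
Hypothesis nd : nondegenerate_tetra x.
Implicit Types (u v : 'cV[poly3 R]_3) (p f : poly3 R).

Definition inner u v : R := tetra_int x (dotv u v).

Lemma innerC u v : inner u v = inner v u.
Proof. by congr tetra_int; apply: eq_bigr => i _; rewrite mulrC. Qed.

Lemma innerDl u v w : inner (u + v) w = inner u w + inner v w.
Proof.
rewrite /inner -tetra_intD //; congr tetra_int.
by rewrite -big_split; apply: eq_bigr => i _; rewrite mxE mulrDl.
Qed.

Definition scalec (c : R) u : 'cV[poly3 R]_3 := mpolyC 3 c *: u.

Lemma innerZl c u v : inner (scalec c u) v = c * inner u v.
Proof.
rewrite /inner -tetra_intZ //; congr tetra_int.
rewrite scaler_sumr; apply: eq_bigr => i _.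
by rewrite mxE mul_mpolyC scalerAl.
Qed.

Lemma innerBl u v w : inner (u - v) w = inner u w - inner v w.
Proof.
have -> : - v = scalec (-1) v by rewrite /scalec mpolyCN mpolyC1 scaleN1r.
by rewrite innerDl innerZl mulN1r.
Qed.

(** The integrand is a sum of squares, hence the zero polynomial, so each component vanishes at
    every point. *)
Lemma inner_eq0 u : inner u u = 0 -> u = 0.
Proof.
move=> /tetra_int_eq0 u0.
have {}u0 : dotv u u = 0.
  apply: u0 => // y _; rewrite peval_sum sumr_ge0 // => i _.
  by rewrite pevalM -expr2 sqr_ge0.
apply/colP => i; rewrite mxE.
apply: (@poly_eq0_open R (fun=> True) _ 0) => [y v _|//|y _]; first by exists 1.
have : \sum_i (peval (u i 0) y) ^+ 2 = 0.
  rewrite -[RHS](pevalC 0 y) mpolyC0 -u0 peval_sum.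
  by apply: eq_bigr => j _; rewrite pevalM expr2.
move/psumr_eq0P => /(_ (fun j _ => sqr_ge0 _)) /(_ i isT) /eqP.
by rewrite sqrf_eq0 => /eqP.
Qed.

Definition bubble (a b : 'I_4) p : 'M[poly3 R]_3 :=
  (bary x a * bary x b * p) *: map_mx (@mpolyC 3 R) (edge_mx x a b).

Definition div_bubble a b p : 'cV[poly3 R]_3 :=
  \col_i (edge x a b i 0 *: dderiv (edge x a b) (bary x a * bary x b * p)).

Lemma mxdiv_bubble a b p : mxdiv (bubble a b p) = div_bubble a b p.
Proof.
apply/colP => i; rewrite !mxE scaler_sumr; apply: eq_bigr => j _.
rewrite !mxE big_ord1 !mxE mulrC mul_mpolyC mderivZ scalerA.
by [].
Qed.

Lemma mxdiv_sum (I : Type) (r : seq I) (P : pred I) (F : I -> 'M[poly3 R]_3) :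
  mxdiv (\sum_(i <- r | P i) F i) = \sum_(i <- r | P i) mxdiv (F i).
Proof.
apply: (big_morph (@mxdiv R)) => [A B|]; apply/colP => i; rewrite !mxE.
  by rewrite -big_split; apply: eq_bigr => j _; rewrite mxE mderivD.
by rewrite big1 // => j _; rewrite mxE mderiv0.
Qed.

(* Integration by parts: the bubble vanishes on the two faces that are not
   parallel to the edge. *)
Lemma inner_div_bubble a b p u : a != b ->
  inner (div_bubble a b p) u
  = - tetra_int x (bary x a * bary x b * p * strain (edge x a b) u).
Proof.
move=> ab; set f := _ * p.
have := tetra_int_dderiv_bubble nd ab (p * tdot (edge x a b) u).
rewrite mulrA -/f dderivM tetra_intD // -/(strain _ u) => /eqP.
rewrite addr_eq0 => /eqP <-.
congr tetra_int; rewrite /dotv /tdot mulr_sumr; apply: eq_bigr => i _.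
by rewrite mxE -scalerAl scalerAr.
Qed.

Definition divergences k := [set mxdiv tau | tau in edge_bubbles x k].

Lemma divergencesP k v : divergences k v <-> exists p : 'I_4 -> 'I_4 -> poly3 R,
  (forall i j : 'I_4, (i < j)%N -> Pm (k - 2) (p i j)) /\
  v = \sum_(i < 4) \sum_(j < 4 | (i < j)%N) div_bubble i j (p i j).
Proof.
have E (p : 'I_4 -> 'I_4 -> poly3 R) :
    mxdiv (\sum_(i < 4) \sum_(j < 4 | (i < j)%N) bubble i j (p i j)) =
    \sum_(i < 4) \sum_(j < 4 | (i < j)%N) div_bubble i j (p i j).
  rewrite mxdiv_sum; apply: eq_bigr => i _; rewrite mxdiv_sum; apply: eq_bigr => j _.
  exact: mxdiv_bubble.
split=> [[_ [p [hp ->]] <-]|[p [hp ->]]]; first by exists p; rewrite E.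
by exists (\sum_(i < 4) \sum_(j < 4 | (i < j)%N) bubble i j (p i j)); [exists p|].
Qed.

Lemma PmB m p q : Pm m p -> Pm m q -> Pm m (p - q).
Proof.
rewrite /Pm /= => hp hq; apply: (leq_trans (mmeasureD_le _ _ _)).
by rewrite geq_max hp mmeasureN hq.
Qed.

Lemma PmZ m c p : Pm m p -> Pm m (c *: p).
Proof. by rewrite /Pm /= => hp; apply: leq_trans (msizeZ_le _ _) hp. Qed.

Lemma Pm0 m : Pm m (0 : poly3 R).
Proof. by rewrite /Pm /= mmeasure0. Qed.

Lemma PmD m p q : Pm m p -> Pm m q -> Pm m (p + q).
Proof.
rewrite /Pm /= => hp hq; apply: (leq_trans (mmeasureD_le _ _ _)).
by rewrite geq_max hp hq.
Qed.

Lemma Pm_sum m (I : Type) (r : seq I) (P : pred I) (F : I -> poly3 R) :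
  (forall i, P i -> Pm m (F i)) -> Pm m (\sum_(i <- r | P i) F i).
Proof. by move=> hF; apply: big_ind => //; [exact: Pm0|exact: PmD]. Qed.

Lemma PmM m n p q : Pm m p -> Pm n q -> Pm (m + n) (p * q).
Proof.
rewrite /Pm /= => hp hq.
have [->|p0] := eqVneq p 0; first by rewrite mul0r mmeasure0.
have [->|q0] := eqVneq q 0; first by rewrite mulr0 mmeasure0.
rewrite msizeM //; move: (msize p) (msize q) hp hq => a b; lia.
Qed.

Lemma Pm_dderiv m t p : Pm m.+1 p -> Pm m (dderiv t p).
Proof.
by move=> hp; apply: Pm_sum => i _; apply/PmZ/msize_mderiv.
Qed.

Lemma Pm_bary i : Pm 1 (bary x i).
Proof.
rewrite /bary mxE; apply: Pm_sum => j _.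
rewrite mxE mul_mpolyC; apply: PmZ; rewrite mxE.
case: (fintype.split j) => l; rewrite mxE /Pm /=.
  by rewrite msize1.
by rewrite msizeX mdeg1.
Qed.

Lemma Pmv_div_bubble m a b p : Pm m p -> Pmv m.+1 (div_bubble a b p).
Proof.
move=> hp i; rewrite mxE; apply/PmZ/Pm_dderiv.
by apply: (PmM (m := 2) (n := m)) => //; apply: (PmM (m := 1) (n := 1)); exact: Pm_bary.
Qed.

Lemma divergences_closed k : closed_span scalec (divergences k).
Proof.
split.
- apply/divergencesP; exists (fun _ _ => 0); split=> [i j _|]; first exact: Pm0.
  rewrite big1 // => i _; rewrite big1 // => j _; apply/colP => l.
  by rewrite !mxE mulr0 -mpolyC0 dderivC scaler0.
- move=> u v /divergencesP[p [hp ->]] /divergencesP[q [hq ->]].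
  apply/divergencesP; exists (fun i j => p i j - q i j); split=> [i j ij|].
    by apply: PmB; [exact: hp|exact: hq].
  rewrite -sumrB; apply: eq_bigr => i _; rewrite -sumrB; apply: eq_bigr => j _.
  by apply/colP => l; rewrite !mxE mulrBr dderivD dderivN scalerBr.
- move=> c u /divergencesP[p [hp ->]].
  apply/divergencesP; exists (fun i j => c *: p i j); split=> [i j ij|].
    by apply: PmZ; exact: hp.
  rewrite /scalec scaler_sumr; apply: eq_bigr => i _.
  rewrite scaler_sumr; apply: eq_bigr => j _.
  apply/colP => l; rewrite !mxE mul_mpolyC -scalerAr dderivZ !scalerA.
  by rewrite mulrC.
Qed.

(** One generator per edge and monomial of degree at most [k - 2]; the bound in [bmultinom] is
    strict, whence the successor. *)
Definition div_generators k : seq 'cV[poly3 R]_3 :=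
  [seq div_bubble ab.1 ab.2 (mpolyX R (bmnm m))
  | ab <- [seq ab : 'I_4 * 'I_4 <- enum {: 'I_4 * 'I_4} | (ab.1 < ab.2)%N],
    m <- enum {: bmultinom 3 (k - 2).+1}].

Lemma div_bubble_divergences k (a b : 'I_4) p : (a < b)%N -> Pm (k - 2) p ->
  divergences k (div_bubble a b p).
Proof.
move=> ab hp; apply/divergencesP.
exists (fun i j => if (i == a) && (j == b) then p else 0); split=> [i j _|].
  by case: ifP => // _; exact: Pm0.
rewrite (bigD1 a) //= (bigD1 b) //= !eqxx /=.
have z i j : div_bubble i j 0 = 0.
  by apply/colP => l; rewrite !mxE mulr0 -mpolyC0 dderivC scaler0.
rewrite [X in _ + X + _]big1 => [|j /andP[_ jb]]; last by rewrite (negPf jb) z.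
rewrite big1 ?addr0 // => i ia; rewrite big1 // => j _.
by rewrite (negPf ia) z.
Qed.

Lemma strain_eq0_of_orthogonal k u : Pmv k.-1 u -> (2 <= k)%N ->
  (forall g, g \in div_generators k -> inner u g = 0) ->
  forall a b : 'I_4, (a < b)%N -> strain (edge x a b) u = 0.
Proof.
move=> uk k2 ug a b ab.
have anb : a != b by apply: contraTneq ab => ->; rewrite ltnn.
(* The strain has one degree less than [u], so it is itself an admissible bubble coefficient. *)
have [p pE] : exists p, p = strain (edge x a b) u by exists (strain (edge x a b) u).
have hp : Pm (k - 2) p.
  rewrite pE.
  apply: Pm_dderiv; apply: Pm_sum => i _; apply: PmZ; have := uk i.
  by have -> : k.-1 = (k - 2).+1 by move: k2; lia.
pose f := bary x a * bary x b.
have gen0 (m : bmultinom 3 (k - 2).+1) : tetra_int x (f * mpolyX R (bmnm m) * p) = 0.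
  apply/eqP; rewrite -oppr_eq0; apply/eqP.
  rewrite pE -inner_div_bubble // innerC.
  apply: ug; apply/allpairsP; exists ((a, b), m) => /=.
  by rewrite mem_filter ab !mem_enum.
(* Orthogonality is known against monomial bubbles only, so one of the two factors [p] is expanded
   into monomials. *)
have fp : tetra_int x (f * p * p) = 0.
  rewrite {1}(mpolywE hp) mulr_sumr mulr_suml.
  have : forall r : seq (bmultinom 3 (k - 2).+1), tetra_int x
     (\sum_(i <- r) f * (mcoeff (bmnm i) p *: mpolyX R (bmnm i)) * p) = 0.
    elim=> [|m r IH].
      by rewrite big_nil -(scale0r 0) tetra_intZ // mul0r.
    by rewrite big_cons tetra_intD // IH addr0 -scalerAr -scalerAl tetra_intZ // gen0 mulr0.
  exact.
rewrite -pE; have : f * p * p = 0.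
  apply: (tetra_int_eq0 nd) fp => y hy; rewrite /f !pevalM -mulrA mulr_ge0 //.
    by rewrite mulr_ge0.
  by rewrite -expr2 sqr_ge0.
move/eqP; rewrite !mulf_eq0 (negPf (bary_eq0F nd a)) (negPf (bary_eq0F nd b)) /= orbb.
by move/eqP.
Qed.

(** By the vertex system the slopes sum to 0 and combine the vertices to [v]; the zero sum allows
    [x ord0] to be subtracted from every vertex. *)
Lemma sum_bary_slope (v : 'cV[R]_3) : v = \sum_i bary_slope x i v *: edge x ord0 i.
Proof.
have Vs : vertex_mx x *m (\col_i bary_slope x i v) = col_mx (0 : 'cV_1) v.
  rewrite (_ : \col_i _ = invmx (vertex_mx x) *m col_mx (0 : 'cV_1) v).
    by rewrite mulKVmx ?vertex_mx_unit.
  by apply/colP => i; rewrite mxE.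
have s0 : \sum_i bary_slope x i v = 0.
  have := congr1 (fun M : 'cV[R]_(1 + 3) => M (lshift 3 0) 0) Vs.
  rewrite /= col_mxEu !mxE => e; rewrite -[RHS]e; apply: eq_bigr => i _.
  by rewrite /vertex_mx col_mxEu !mxE mul1r.
rewrite /edge; under eq_bigr do rewrite scalerBr.
rewrite sumrB -scaler_suml s0 scale0r subr0.
apply/colP => r; rewrite summxE.
have := congr1 (fun M : 'cV[R]_(1 + 3) => M (rshift 1 r) 0) Vs.
rewrite /= col_mxEd mxE => e; rewrite -[LHS]e; apply: eq_bigr => i _.
by rewrite /vertex_mx col_mxEd !mxE mulrC.
Qed.

Lemma rigid_of_strain_edges u :
  (forall a b : 'I_4, (a < b)%N -> strain (edge x a b) u = 0) -> rigid_motions u.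
Proof.
move=> s0; apply: rigid_of_symmetric_gradient => i j.
rewrite -strain_polar_delta.
pose P t t' := strain_polar t t' u.
have PZr c t t' : P t (c *: t') = c *: P t t'.
  by rewrite /P strain_polarC strain_polarZl strain_polarC.
have PDr t t' t'' : P t (t' + t'') = P t t' + P t t''.
  by rewrite /P strain_polarC strain_polarDl !(strain_polarC t).
have edgeE a b c : edge x a b = edge x c b + (-1) *: edge x c a.
  by rewrite /edge scaleN1r opprB addrA subrK.
have Pd (a b : 'I_4) : P (edge x a b) (edge x a b) = 0.
  have [ab|ba|/val_inj ->] := ltngtP a b.
  - by rewrite /P strain_polar_diag s0 ?scaler0.
  - have -> : edge x a b = (-1) *: edge x b a by rewrite /edge scaleN1r opprB.
    by rewrite PZr /P strain_polarZl strain_polar_diag s0 // !scaler0.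
  - by rewrite /edge subrr -{1}(scale0r 0) /P strain_polarZl scale0r.
(* Expanding the form at [t' - t] leaves only [- 2 P t t']. *)
have polarization t t' : P t t = 0 -> P t' t' = 0 ->
    P (t' + (-1) *: t) (t' + (-1) *: t) = 0 -> P t t' = 0.
  move=> h h'; rewrite {1}/P strain_polarDl strain_polarZl -!/(P _ _).
  rewrite !(PDr, PZr) h h' !(scaler0, addr0, add0r).
  rewrite {1}/P strain_polarC -/(P _ _) -scalerDr => /eqP.
  by rewrite scaler_eq0 oppr_eq0 oner_eq0 -mulr2n -scaler_nat scaler_eq0 pnatr_eq0 => /eqP.
(* The third side of the triangle [0, a, b] is the difference of the two others, so polarization
   applies; the edges from vertex 0 span the space. *)
have Pe (a b : 'I_4) : P (edge x ord0 a) (edge x ord0 b) = 0.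
  by apply: polarization; rewrite -?edgeE.
rewrite (sum_bary_slope (delta_mx i 0)) strain_polar_suml big1 // => a _.
rewrite strain_polarC (sum_bary_slope (delta_mx j 0)) strain_polar_suml big1 ?scaler0 // => b _.
by rewrite -/(P _ _) Pe scaler0.
Qed.

Lemma inner_div_rigid k v r : divergences k v -> rigid_motions r -> inner v r = 0.
Proof.
move=> /divergencesP[p [_ ->]] hr.
have in0 : inner 0 r = 0 by rewrite -(subrr 0) innerBl subrr.
have inS := big_morph (fun v => inner v r) (fun v w => innerDl v w r) in0.
rewrite inS big1 // => i _; rewrite inS big1 // => j ij.
rewrite inner_div_bubble; last by apply: contraTneq ij => ->; rewrite ltnn.
by rewrite strain_rigid // mulr0 -(scale0r 0) tetra_intZ // mul0r oppr0.
Qed.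

End Bubbles.

(** * Divergences of bubbles as the orthogonal complement of the rigid motions *)

Theorem mainTheorem3 (R : realType) (k : nat) (hk : (4 <= k)%N)
    (x : 'I_4 -> 'cV[R]_3) (hx : nondegenerate_tetra x) :
  [set mxdiv tau | tau in edge_bubbles x k]
  = [set v | Pmv k.-1 v /\
      forall p, rigid_motions p ->
        (\int[@lebesgue3 R]_(y in tetra x) (peval (dotv v p) (vec3 y))%:E = 0)%E].
Proof.
have k2 : (2 <= k)%N by exact: leq_trans hk.
have kE : k.-1 = (k - 2).+1 by move: k2; lia.
have innerP (v p : 'cV[poly3 R]_3) :
    (\int[@lebesgue3 R]_(y in tetra x) (peval (dotv v p) (vec3 y))%:E = 0)%E <->
    inner x v p = 0.
  by rewrite tetra_intE // -/(inner x v p); split=> [[]|->].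
have sub v : divergences x k v -> Pmv k.-1 v /\ forall p, rigid_motions p -> inner x v p = 0.
  move=> dv; split=> [l|r]; last exact: (inner_div_rigid hx dv).
  move: dv => /divergencesP[p [hp ->]].
  rewrite summxE; apply: Pm_sum => i _; rewrite summxE; apply: Pm_sum => j ij.
  by rewrite kE; exact: (Pmv_div_bubble _ _ _ (hp i j ij)).
apply/seteqP; split=> v.
  by move=> /sub [vk vr]; split=> // p /vr /innerP.
move=> [vk vr].
(* [w] is the projection of [v] onto the divergences; what remains is to show that the residual
   [v - w] is zero. *)
have [w ws wo] := orthogonal_projection (innerBl hx) (innerZl hx) (@innerC _ x)
  (inner_eq0 hx) (div_generators x k) v.
have wW : divergences x k w.
  apply: ws; first exact: divergences_closed.
  move=> _ /allpairsP[[[a b] m] [/= + _ ->]]; rewrite mem_filter => /andP[/= ab _].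
  apply: div_bubble_divergences => //.
  by rewrite /Pm /= msizeX; case: m.
have [wk wr] := sub w wW.
have uk : Pmv k.-1 (v - w).
  by move=> i; rewrite !mxE; apply: PmB; [exact: vk|exact: wk].
have rig := rigid_of_strain_edges hx (strain_eq0_of_orthogonal hx uk k2 wo).
(* The second argument is a rigid motion by [rig], and both [v] and [w] are orthogonal to rigid
   motions. *)
have : inner x (v - w) (v - w) = 0.
  by rewrite innerBl // wr // subr0; apply/innerP/vr.
move=> /(inner_eq0 hx) /eqP; rewrite subr_eq0 => /eqP ->.
exact: wW.
Qed.
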